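(* Let $f=\frac1n\sum_{i=1}^n f_i$ satisfy: (1) each $\nabla f_i$ is $L$-Lipschitz on $\mathbb{R}^d$; (2) $f^*=\inf_{x} f(x)>-\infty$; (3) there is $\sigma>0$ with $\frac1n\sum_{i=1}^n\|\nabla f_i(x)-\nabla f(x)\|^2\le\sigma^2$ for all $x\in\mathbb{R}^d$. Let $\epsilon>0$. For any mini-batch size $B\le n^{1/2}\wedge\epsilon^{-1/2}$, set the epoch length $m=(n\wedge\frac1\epsilon)B^{-1}$, the stepsize $\eta=\frac1{4L}\sqrt{\frac Bm}$, $c_\beta,c_\epsilon\ge16$, and $0<\beta_1\le S\epsilon$, where $S$ is the number of epochs and $K=Sm$. Then, to obtain an $\epsilon$-accurate solution $x_\zeta$, i.e. $\mathbb{E}\|\nabla f(x_\zeta)\|^2\le\epsilon$ for the output $x_\zeta$ of AbaSPIDER, the total SFO complexity of AbaSPIDER is given by $$\underbrace{\sum_{s=1}^S\min\Big\{\frac{c_\beta\sigma^2}{\sum_{t=1}^m\|v_{t-1}^{s-1}\|^2/m},\,c_\epsilon\sigma^2\epsilon^{-1},\,n\Big\}+KB}_{\text{complexity of AbaSPIDER}}\ <\ \underbrace{S\min\{c_\epsilon\sigma^2\epsilon^{-1},n\}+KB}_{\text{complexity of vanilla SPIDER}}=\mathcal{O}\big(\epsilon^{-1}(n\wedge\epsilon^{-1})^{1/2}\big),$$ where for $s=1$ the quantity $\sum_{t=1}^m\|v_{t-1}^{s-1}\|^2/m$ stands for the input $\beta_1$.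
   Context: $a\wedge b=\min\{a,b\}$. For a finite index set (or list) $\mathcal{S}$, $\nabla f_{\mathcal{S}}(\cdot)=\frac1{|\mathcal{S}|}\sum_{i\in\mathcal{S}}\nabla f_i(\cdot)$. AbaSPIDER. Inputs: $x_0\in\mathbb{R}^d$, epoch length $m$, mini-batch size $B$, number of epochs $S$, and reals $\eta,c_\beta,c_\epsilon,\beta_1>0$; $\epsilon>0$ is the target accuracy. Set $\tilde x^0=x_0$. For $s=1,\dots,S$: set $x_0^s=\tilde x^{s-1}$; sample $\mathcal{N}_s$ from $[n]=\{1,\dots,n\}$ uniformly without replacement, of size $N_s=\min\{c_\beta\sigma^2\beta_s^{-1},\,c_\epsilon\sigma^2\epsilon^{-1},\,n\}$; set $v_0^s=\nabla f_{\mathcal{N}_s}(\tilde x^{s-1})$ and $x_1^s=x_0^s-\eta v_0^s$; for $t=1,\dots,m-1$, draw a fresh mini-batch $\mathcal{B}$ of size $B$ uniformly from $[n]$ with replacement and set $v_t^s=\nabla f_{\mathcal{B}}(x_t^s)-\nabla f_{\mathcal{B}}(x_{t-1}^s)+v_{t-1}^s$, $x_{t+1}^s=x_t^s-\eta v_t^s$; finally set $\beta_{s+1}=\frac1m\sum_{t=0}^{m-1}\|v_t^s\|^2$ and $\tilde x^s=x_m^s$. The output $x_\zeta$ is chosen uniformly at random from $\{x_{t-1}^s\}_{s\in[S],\,t\in[m]}$. Sizes that are not integers are understood to be rounded. SFO complexity: the stochastic first-order oracle (SFO), given $x$, takes a random index $i\in[n]$ and returns $\nabla f_i(x)$ with $\mathbb{E}_i[\nabla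 f_i(x)]=\nabla f(x)$; the SFO complexity is the number of oracle calls, counted as in the displayed expressions. Vanilla SPIDER is the same method with the fixed outer batch size $\min\{c_\epsilon\sigma^2\epsilon^{-1},n\}$. $\mathcal{O}(\cdot)$ hides constants that do not depend on $n$, $B$, $\epsilon$.
   Formalization: The strict ''<'' fails (e.g. all f_i constant and β_1 small give equality); what is proved is ''≤'' on every run, with ''<'' exactly when c_βσ² < β_s·min{c_εσ²/ε, n} for some epoch s. *)

(* Defs.v *)
From HB Require Import structures.
From mathcomp Require Import all_boot all_order all_algebra.
From mathcomp Require Import boolp classical_sets reals topology normedtype derive.

Set Implicit Arguments.
Unset Strict Implicit.
Unset Printing Implicit Defensive.

Import Order.TTheory GRing.Theory Num.Theory.
Import numFieldNormedType.Exports.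
Local Open Scope ring_scope.

(* A finitely supported distribution is a list of (probability, outcome)
   pairs; an outcome may be listed several times. *)
Section FiniteDistributions.
Variable R : realType.

Definition fdist (A : Type) := seq (R * A).

Definition dret (A : Type) (a : A) : fdist A := [:: (1, a)].

Definition dbind (A B : Type) (d : fdist A) (k : A -> fdist B) : fdist B :=
  [seq (p.1 * q.1, q.2) | p <- d, q <- k p.2].

Definition duniform (A : Type) (s : seq A) : fdist A :=
  [seq ((size s)%:R^-1, a) | a <- s].

Definition expectation (A : Type) (d : fdist A) (g : A -> R) : R :=
  \sum_(p <- d) p.1 * g p.2.

Definition outcomes (A : Type) (d : fdist A) : seq A := [seq p.2 | p <- d].

End FiniteDistributions.

Section Euclidean.
Variables (R : realType) (d : nat).
Implicit Types (x : 'rV[R]_d) (f : 'rV[R]_d -> R).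

(* The norm `|x| of the library on 'rV[R]_d is the sup norm. *)
Definition norm2 x : R := Num.sqrt (\sum_(j < d) x 0 j ^+ 2).

Definition gradient f x : 'rV[R]_d := \row_j 'D_(delta_mx 0 j) f x.

End Euclidean.

(* Any convention for turning a positive real size into a positive integer:
   integers are unchanged, other reals go to one of the two neighbouring
   integers, and never to 0. *)
Definition rounding (R : realType) (rnd : R -> nat) : Prop :=
  forall x : R, 0 < x -> (0 < rnd x)%N /\ `|(rnd x)%:R - x| < 1.

Section FiniteSum.
Variables (R : realType) (d n : nat) (f : 'I_n -> 'rV[R]_d -> R).

Definition favg (x : 'rV[R]_d) : R := n%:R^-1 * \sum_(i < n) f i x.

Definition batch_gradient (s : seq 'I_n) (x : 'rV[R]_d) : 'rV[R]_d :=
  (size s)%:R^-1 *: \sum_(i <- s) gradient (f i) x.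

End FiniteSum.

Section OuterBatch.
Variables (R : realType) (n : nat) (sigma eps cbeta ceps : R).

Definition spider_size : R := Num.min (ceps * sigma ^+ 2 / eps) n%:R.

(* The case split is there because cbeta * sigma ^+ 2 / beta means +oo at
   beta = 0, whereas x / 0 = 0 in the library. *)
Definition aba_size (beta : R) : R :=
  if beta == 0 then spider_size
  else Num.min (cbeta * sigma ^+ 2 / beta) spider_size.

End OuterBatch.

Section AbaSPIDER.
Variables (R : realType) (d n : nat) (f : 'I_n -> 'rV[R]_d -> R).
Variables (rnd : R -> nat) (sigma eps cbeta ceps eta : R) (m B : nat).

Local Notation point := 'rV[R]_d.

(* The trace of an epoch is [:: (x_0, v_0); ...; (x_(m-1), v_(m-1))]. *)
Definition trace : Type := seq (point * point).

(* Continues an epoch for k more steps after the current pair (x, v). *)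
Fixpoint inner_loop (k : nat) (x v : point) : fdist R trace :=
  if k is k'.+1 then
    dbind (duniform R (enum {: B.-tuple 'I_n})) (fun b =>
      let x' := x - eta *: v in
      let v' := batch_gradient f b x' - batch_gradient f b x + v in
      dbind (inner_loop k' x' v') (fun tr => dret R ((x, v) :: tr)))
  else dret R [:: (x, v)].

Definition epoch (N : nat) (x : point) : fdist R trace :=
  dbind (duniform R (enum [set A : {set 'I_n} | #|A| == N])) (fun A =>
    inner_loop m.-1 x (batch_gradient f (enum A) x)).

Definition next_beta (tr : trace) : R :=
  m%:R^-1 * \sum_(p <- tr) norm2 p.2 ^+ 2.

Definition next_point (tr : trace) : point :=
  let p := last (0, 0) tr in p.1 - eta *: p.2.

Fixpoint abaspider_run (S : nat) (beta : R) (x : point) :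
    fdist R (seq trace) :=
  if S is S'.+1 then
    dbind (epoch (rnd (aba_size n sigma eps cbeta ceps beta)) x) (fun tr =>
      dbind (abaspider_run S' (next_beta tr) (next_point tr)) (fun r =>
        dret R (tr :: r)))
  else dret R [::].

Definition abaspider (S : nat) (beta1 : R) (x0 : point) : fdist R point :=
  dbind (abaspider_run S beta1 x0) (fun r =>
    duniform R [seq p.1 | p <- flatten r]).

(* beta_(s+1), with epochs counted from s = 0. *)
Definition beta_of (beta1 : R) (r : seq trace) (s : nat) : R :=
  nth 0 (beta1 :: [seq next_beta tr | tr <- r]) s.

Definition abaspider_sfo (S : nat) (beta1 : R) (r : seq trace) : R :=
  \sum_(s < S) aba_size n sigma eps cbeta ceps (beta_of beta1 r s)
  + (S * m * B)%:R.

Definition spider_sfo (S : nat) : R :=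
  S%:R * spider_size n sigma eps ceps + (S * m * B)%:R.

End AbaSPIDER.

(* Main.v *)
Require Import Defs.
From HB Require Import structures.
From mathcomp Require Import all_boot all_order all_algebra.
From mathcomp Require Import boolp classical_sets reals topology normedtype derive.
From mathcomp Require Import functions ring lra zify.
Set Implicit Arguments.
Unset Strict Implicit.
Import Order.TTheory GRing.Theory Num.Theory.
Import numFieldNormedType.Exports.
Local Open Scope ring_scope.

(** Write [F] for the average of the [f i], [G] for its gradient, [M] for the
    minimum of [n] and [1 / eps].  The accuracy bound is a descent argument in
    which the errors of the gradient estimators are paid for by the terms
    [norm2 v ^+ 2] that the descent lemma leaves over.

    A step from [x] along [v] decreases [F] by [eta / 2 * norm2 (G x) ^+ 2]
    plus nearly [eta / 2 * norm2 v ^+ 2], up to [eta / 2] times the squared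
    error [norm2 (G x - v) ^+ 2] ([descent_step]).  A SPIDER update adds to the
    expected squared error at most [L ^+ 2 / B * eta ^+ 2 * norm2 v ^+ 2]
    ([mean_sq_spider_error]); the stepsize is such that [m] of these amounts
    make up [norm2 v ^+ 2 / 16].  Hence, over one epoch, only the error of the
    initial batch gradient counts, once for each of the [m] steps
    ([inner_loop_energy], [epoch_energy]).  With [cbeta, ceps >= 16], and a
    factor [2] lost to rounding, that error is at most [(beta_s + eps) / 8]
    ([aba_batch_variance]).  Since [m * beta_(s+1)] is the sum of the
    [norm2 v ^+ 2] over epoch [s], the part of the error due to [beta_(s+1)]
    is again paid for by what the descent in the previous epoch leaves over:
    this is why a batch size adapted to [beta_s] does not spoil the rate.  The
    epochs telescope ([run_energy]), and what remains is [beta_1 / (8 S)],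
    [eps / 8] and [2 (F x0 - inf F) / (eta S m)].

    As [eta * m] is of order [sqrt M / L], a number [S] of epochs of order
    [L * Delta / (eps * sqrt M)] makes the last term small
    ([epochs_accuracy]); as an epoch costs vanilla SPIDER [O(M)] calls, its
    total cost is [O(sqrt M / eps)].  The comparison of the two costs holds
    term by term on every run: the adaptive batch size is the vanilla one
    capped by [cbeta * sigma ^+ 2 / beta_s] ([abaspider_sfo_leif]). *)

(** * Euclidean norm and inner product *)

Definition dot {R : realType} {d : nat} (u v : 'rV[R]_d) : R :=
  \sum_(j < d) u 0 j * v 0 j.

Lemma norm2_sq (R : realType) d (u : 'rV[R]_d) :
  norm2 u ^+ 2 = \sum_(j < d) u 0 j ^+ 2.
Proof. by rewrite sqr_sqrtr// sumr_ge0 // => j _; apply: sqr_ge0. Qed.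

(** Expand the square of [u - c *: v]. The free scale [c] lets this inequality
    do the work of Cauchy-Schwarz when the ratio of the two norms is known. *)
Lemma dot_young (R : realType) d (c : R) (u v : 'rV[R]_d) :
  2 * c * dot u v <= norm2 u ^+ 2 + c ^+ 2 * norm2 v ^+ 2.
Proof.
rewrite !norm2_sq mulr_sumr mulr_sumr -big_split /=; apply: ler_sum => j _.
have := sqr_ge0 (u 0 j - c * v 0 j); nra.
Qed.

Lemma norm2_ge0 (R : realType) d (u : 'rV[R]_d) : 0 <= norm2 u.
Proof. exact: sqrtr_ge0. Qed.

Lemma norm2Z_sq (R : realType) d (a : R) (u : 'rV[R]_d) :
  norm2 (a *: u) ^+ 2 = a ^+ 2 * norm2 u ^+ 2.
Proof.
by rewrite !norm2_sq mulr_sumr; apply: eq_bigr => j _; rewrite mxE exprMn.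
Qed.

Lemma dotBl (R : realType) d (u v w : 'rV[R]_d) :
  dot (u - v) w = dot u w - dot v w.
Proof. by rewrite -sumrB; apply: eq_bigr => j _; rewrite !mxE mulrBl. Qed.

Lemma norm2B_sq (R : realType) d (u v : 'rV[R]_d) :
  norm2 (u - v) ^+ 2 = norm2 u ^+ 2 - 2 * dot u v + norm2 v ^+ 2.
Proof.
rewrite !norm2_sq mulr_sumr -sumrB -big_split /=.
by apply: eq_bigr => j _; rewrite !mxE; ring.
Qed.

Lemma rowBE (R : realType) d (u v : 'rV[R]_d) j : (u - v) 0 j = u 0 j - v 0 j.
Proof. by rewrite !mxE. Qed.

Lemma rowDE (R : realType) d (u v : 'rV[R]_d) j : (u + v) 0 j = u 0 j + v 0 j.
Proof. by rewrite !mxE. Qed.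

Lemma rowZE (R : realType) d (a : R) (u : 'rV[R]_d) j : (a *: u) 0 j = a * u 0 j.
Proof. by rewrite !mxE. Qed.

Lemma dotZr (R : realType) d (a : R) (u v : 'rV[R]_d) :
  dot u (a *: v) = a * dot u v.
Proof. by rewrite mulr_sumr; apply: eq_bigr => j _; rewrite mxE mulrCA. Qed.

(** * The descent lemma *)

Lemma derive_gradient (R : realType) d (f : 'rV[R]_d -> R) (x h : 'rV[R]_d) :
  differentiable f x -> 'D_h f x = dot (gradient f x) h.
Proof.
move=> df; rewrite deriveE// {1}(row_sum_delta h) raddf_sum /=.
by apply: eq_bigr => j _; rewrite linearZ /= mxE deriveE// mulrC.
Qed.

(** The difference quotients of the restriction of [f] to a line are those of
    [f] in the direction of that line. *)
Lemma is_derive_line (R : realType) d (f : 'rV[R]_d -> R) (x h : 'rV[R]_d)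
    (t : R) :
  differentiable f (x + t *: h) ->
  is_derive t 1 (fun s : R => f (x + s *: h)) (dot (gradient f (x + t *: h)) h).
Proof.
move=> df; have E : (fun s : R => s^-1 *: (f (x + (s *: (1 : R) + t) *: h) -
  f (x + t *: h))) = (fun s => s^-1 *: (f (s *: h + (x + t *: h)) - f (x + t *: h))).
  apply/funext => s; congr (_ *: (f _ - _)).
  by rewrite /GRing.scale /= mulr1 -/(GRing.scale _ _) scalerDl addrCA.
split.
- by rewrite /derivable /= E; apply: diff_derivable.
- by rewrite /derive /= E -derive_gradient.
Qed.

(** Along the segment from [x] to [x + h], the slope of [f] exceeds its initial
    value by at most [L * t * norm2 h ^+ 2] at time [t]. So [f] minus the
    quadratic with that slope is nonincreasing on the unit interval; the mean
    value theorem compares its two ends. *)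
Lemma descent_lemma (R : realType) d (f : 'rV[R]_d -> R) (L : R) (x h : 'rV[R]_d) :
  0 < L -> (forall y, differentiable f y) ->
  (forall y z, norm2 (gradient f y - gradient f z) <= L * norm2 (y - z)) ->
  f (x + h) <= f x + dot (gradient f x) h + L / 2 * norm2 h ^+ 2.
Proof.
move=> L0 df Lf.
pose q := L / 2 * norm2 h ^+ 2; pose s0 := dot (gradient f x) h.
pose g (t : R) := f (x + t *: h) - (s0 * t + q * t ^+ 2).
pose dg (t : R) := dot (gradient f (x + t *: h)) h - (s0 + q * (2 * t)).
have dgP (t : R) : is_derive t 1 g (dg t).
  pose Q : R -> R := (s0 \*: (id : R -> R)) + (q \*: ((id : R -> R) ^+ 2)).
  have -> : g = (fun s => f (x + s *: h)) - Q by apply/funext.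
  have quad : is_derive t 1 Q (s0 + q * (2 * t)).
    by apply: is_derive_eq; rewrite /GRing.scale /=; ring.
  exact: is_deriveB (is_derive_line (df _)) quad.
have gcont : {within `[0, 1], continuous g}%classic.
  by apply: derivable_within_continuous => t _; apply: ex_derive.
have [c c01] := MVT ltr01 (fun t _ => dgP t) gcont.
have {c01}[c0 c1] : 0 < c /\ c < 1 by move: c01; rewrite in_itv /= => /andP.
have dgc : dg c <= 0.
  have Lc : 0 < L * c by rewrite mulr_gt0.
  (* The scale [L * c] is the Lipschitz bound on the ratio of the two norms, so
     the inequality of Young loses nothing here. *)
  have y := dot_young (L * c) (gradient f (x + c *: h) - gradient f x) h.
  have : norm2 (gradient f (x + c *: h) - gradient f x) ^+ 2
      <= (L * c) ^+ 2 * norm2 h ^+ 2.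
    apply: (@le_trans _ _ ((L * norm2 (c *: h)) ^+ 2)).
      rewrite ler_sqr ?nnegrE ?mulr_ge0 ?norm2_ge0 ?(ltW L0)//.
      by have := Lf (x + c *: h) x; rewrite addrAC subrr add0r.
    by rewrite exprMn norm2Z_sq exprMn mulrA.
  rewrite /dg /s0 /q; move: y; rewrite dotBl; set D := _ - _; set N := norm2 h ^+ 2.
  move=> y1 y2.
  have : 2 * (L * c) * D <= 2 * (L * c) * (L * c * N) by nra.
  rewrite ler_pM2l ?mulr_gt0// => H.
  by rewrite opprD addrA -/D; lra.
rewrite /g scale0r scale1r addr0 => E.
rewrite -/s0 -/q; lra.
Qed.

(** * Expectations over finitely supported distributions *)

Section Expectation.
Variable R : realType.

Definition is_dist (A : Type) (D : fdist R A) : Prop :=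
  all (fun p => 0 <= p.1) D /\ \sum_(p <- D) p.1 = 1.

Lemma expectation_dbind (A B : Type) (D : fdist R A) (k : A -> fdist R B) g :
  expectation (dbind D k) g = expectation D (fun a => expectation (k a) g).
Proof.
rewrite /expectation /dbind big_allpairs_dep /=.
apply: eq_bigr => p _; rewrite mulr_sumr.
by apply: eq_bigr => q _; rewrite mulrA.
Qed.

Lemma expectation_dret (A : Type) (a : A) (g : A -> R) :
  expectation (dret R a) g = g a.
Proof. by rewrite /expectation big_seq1 mul1r. Qed.

Lemma expectation_duniform (A : Type) (s : seq A) (g : A -> R) :
  expectation (duniform R s) g = (size s)%:R^-1 * \sum_(a <- s) g a.
Proof. by rewrite /expectation big_map mulr_sumr. Qed.

Lemma expectationD (A : Type) (D : fdist R A) (g h : A -> R) :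
  expectation D (fun a => g a + h a) = expectation D g + expectation D h.
Proof. by rewrite -big_split /=; apply: eq_bigr => p _; rewrite mulrDr. Qed.

Lemma expectationZ (A : Type) (D : fdist R A) (c : R) (g : A -> R) :
  expectation D (fun a => c * g a) = c * expectation D g.
Proof. by rewrite mulr_sumr; apply: eq_bigr => p _; rewrite mulrCA. Qed.

Lemma expectation_cst (A : Type) (D : fdist R A) (c : R) :
  is_dist D -> expectation D (fun=> c) = c.
Proof. by case=> _ D1; rewrite /expectation -mulr_suml D1 mul1r. Qed.

Lemma expectation_le (A : Type) (D : fdist R A) (g h : A -> R) :
  is_dist D -> (forall a, g a <= h a) -> expectation D g <= expectation D h.
Proof.
case=> D0 _ gh; rewrite /expectation; elim: D D0 => [|p D IH] /=.
  by rewrite !big_nil.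
by case/andP=> p0 D0; rewrite !big_cons lerD ?IH// ler_wpM2l.
Qed.

Lemma eq_expectation (A : eqType) (D : fdist R A) (g h : A -> R) :
  (forall a, a \in outcomes D -> g a = h a) ->
  expectation D g = expectation D h.
Proof.
move=> gh; rewrite /expectation big_seq [RHS]big_seq; apply: eq_bigr => p pD.
by rewrite gh//; apply/mapP; exists p.
Qed.

Lemma is_dist_dret (A : Type) (a : A) : is_dist (dret R a).
Proof. by rewrite /is_dist big_seq1 /= ler01. Qed.

Lemma is_dist_duniform (A : Type) (s : seq A) :
  (0 < size s)%N -> is_dist (duniform R s).
Proof.
move=> s0; split.
  rewrite all_map (eq_all (a2 := predT)) ?all_predT// => a /=.
  by rewrite invr_ge0 ler0n.
rewrite big_map /= big_const_seq count_predT iter_addr addr0 -[X in X *+ _]mulr1 -mulrnAr.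
by rewrite mulVf// pnatr_eq0 -lt0n.
Qed.

Lemma is_dist_dbind (A B : Type) (D : fdist R A) (k : A -> fdist R B) :
  is_dist D -> (forall a, is_dist (k a)) -> is_dist (dbind D k).
Proof.
move=> dD dk; split.
  case: dD => + _; rewrite /dbind; elim: D => //= p D IH /andP[p0 D0].
  rewrite all_cat IH// andbT all_map.
  elim: (k p.2) (proj1 (dk p.2)) => //= q s IHs.
  by case/andP=> q0 s0; rewrite mulr_ge0 ?IHs.
have dE (C : Type) (E : fdist R C) : \sum_(p <- E) p.1 = expectation E (fun=> 1).
  by apply: eq_bigr => p _; rewrite mulr1.
rewrite dE expectation_dbind -[RHS](expectation_cst 1 dD).
by congr expectation; apply/funext => a; rewrite expectation_cst.
Qed.

Lemma outcomes_dbind (A B : eqType) (D : fdist R A) (k : A -> fdist R B) b :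
  b \in outcomes (dbind D k) ->
  exists2 a, a \in outcomes D & b \in outcomes (k a).
Proof.
rewrite /outcomes => /mapP[pb + ->].
move=> /allpairsPdep[p [q [pD qk ->]]].
by exists p.2; apply/mapP; [exists p|exists q].
Qed.

Lemma expectation_sum (A : Type) (I : finType) (D : fdist R A)
    (g : I -> A -> R) :
  expectation D (fun a => \sum_(i : I) g i a) = \sum_(i : I) expectation D (g i).
Proof. by rewrite exchange_big /=; apply: eq_bigr => p _; rewrite mulr_sumr. Qed.

Lemma outcomes_duniform (A : Type) (s : seq A) :
  outcomes (duniform R s) = s.
Proof. by rewrite /outcomes -map_comp map_id. Qed.

End Expectation.

(** * Second moments of batch means *)

Section Sampling.
Variables (R : realType) (n : nat).
Implicit Types Y : 'I_n -> R.

Lemma sum_tuple_cons (k : nat) (G : seq 'I_n -> R) :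
  \sum_(b : k.+1.-tuple 'I_n) G b = \sum_(i < n) \sum_(b : k.-tuple 'I_n) G (i :: b).
Proof.
rewrite pair_big /=.
rewrite (reindex (fun p : 'I_n * k.-tuple 'I_n => [tuple of p.1 :: p.2])) //=.
exists (fun b : k.+1.-tuple 'I_n => (thead b, [tuple of behead b])).
  by case=> i b _ /=; congr pair; apply: val_inj.
by move=> b _ /=; rewrite -tuple_eta.
Qed.

(** Bias-variance decomposition for [k] independent uniform draws, by induction
    on [k]: the first draw [i] is absorbed in the shift, which becomes
    [Y i + c]. This is why the shift has to be arbitrary. *)
Lemma sum_sq_with_replacement (Y : 'I_n -> R) (k : nat) (mu c : R) :
  \sum_(i < n) Y i = n%:R * mu ->
  \sum_(b : k.-tuple 'I_n) ((\sum_(i <- b) Y i) + c) ^+ 2 =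
  n%:R ^+ k * (k%:R * mu + c) ^+ 2
  + k%:R * n%:R ^+ k.-1 * \sum_(i < n) (Y i - mu) ^+ 2.
Proof.
move=> Ymu.
have var0 (a : R) : \sum_(i < n) (Y i + a) ^+ 2 =
    \sum_(i < n) (Y i - mu) ^+ 2 + n%:R * (mu + a) ^+ 2.
  rewrite (eq_bigr (fun i => (Y i - mu) ^+ 2 + (2 * (mu + a) * (Y i - mu)
    + (mu + a) ^+ 2))); last by move=> i _; ring.
  rewrite big_split /= big_split /= -mulr_sumr sumrB Ymu !sumr_const card_ord.
  by rewrite -[mu *+ _]mulr_natl subrr mulr0 add0r -[(mu + a) ^+ 2 *+ _]mulr_natl.
elim: k c => [|k IH] c.
  rewrite (big_pred1 [tuple]) => [|b]; last by apply/esym/eqP; exact: tuple0.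
  by rewrite big_nil expr0 /= !mul0r addr0 mul1r.
rewrite (sum_tuple_cons k (fun b => ((\sum_(i <- b) Y i) + c) ^+ 2)).
under eq_bigr => i _.
  under eq_bigr => b _ do rewrite big_cons -addrA addrCA.
  rewrite IH addrCA.
  over.
rewrite /= big_split /= -!mulr_sumr var0 sumr_const card_ord -mulr_natl.
case: k {IH} => [|k] /=; rewrite ?natr1 ?exprS ?expr0.
  by ring.
by rewrite -[k.+2%:R]natr1 -[k.+1%:R]natr1; ring.
Qed.

(** The mean of a batch of size [B] has mean [mu] and variance one [B]-th of that
    of [Y], and a variance is at most a second moment. *)
Lemma mean_sq_with_replacement (Y : 'I_n -> R) (B : nat) (mu c : R) :
  (0 < n)%N -> (0 < B)%N -> \sum_(i < n) Y i = n%:R * mu ->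
  expectation (duniform R (enum {: B.-tuple 'I_n}))
    (fun b => (B%:R^-1 * (\sum_(i <- b) Y i) + c) ^+ 2)
  <= (mu + c) ^+ 2 + B%:R^-1 * (n%:R^-1 * \sum_(i < n) Y i ^+ 2).
Proof.
move=> n0 B0 Ymu.
have n0' : n%:R != 0 :> R by rewrite pnatr_eq0 -lt0n.
have B0' : B%:R != 0 :> R by rewrite pnatr_eq0 -lt0n.
rewrite expectation_duniform -cardE card_tuple card_ord natrX big_enum /=.
rewrite (eq_bigr (fun b : B.-tuple 'I_n =>
   B%:R ^- 2 * ((\sum_(i <- b) Y i) + B%:R * c) ^+ 2)); last first.
  by move=> b _; field.
rewrite -mulr_sumr (sum_sq_with_replacement _ _ Ymu).
have varle : \sum_(i < n) (Y i - mu) ^+ 2 <= \sum_(i < n) Y i ^+ 2.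
  have -> : \sum_(i < n) (Y i - mu) ^+ 2
     = \sum_(i < n) Y i ^+ 2 - n%:R * mu ^+ 2.
    rewrite (eq_bigr (fun i => Y i ^+ 2 - 2 * mu * Y i + mu ^+ 2)); last first.
      by move=> i _; ring.
    rewrite big_split /= sumrB -mulr_sumr Ymu sumr_const card_ord -mulr_natl.
    by ring.
  by rewrite gerBl mulr_ge0 ?sqr_ge0.
apply: (@le_trans _ _ ((mu + c) ^+ 2
   + B%:R^-1 * (n%:R^-1 * \sum_(i < n) (Y i - mu) ^+ 2))).
  rewrite le_eqVlt; apply/orP; left; apply/eqP.
  case: B B0 B0' => // B _ B0' /=; rewrite [_ ^+ B.+1]exprS.
  have nB : n%:R ^+ B != 0 :> R by rewrite expf_neq0.
  move: (B.+1%:R : R) B0' => b b0.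
  by field; rewrite n0' nB b0.
by rewrite lerD2l !ler_wpM2l ?invr_ge0.
Qed.

(** Complementation turns the supersets of [D] into the subsets of its
    complement. *)
Lemma card_supersets (D : {set 'I_n}) (k : nat) : (k <= n)%N ->
  #|[set A : {set 'I_n} | (D \subset A) && (#|A| == k)]| = 'C(n - #|D|, n - k).
Proof.
move=> kn.
have -> : [set A : {set 'I_n} | (D \subset A) && (#|A| == k)]
   = [set ~: A | A in [set A : {set 'I_n} | A \subset ~: D & #|A| == (n - k)%N]].
  apply/setP => A; rewrite -[in RHS](finset.setCK A) mem_imset; last exact: finset.setC_inj.
  rewrite !inE finset.setCS; congr andb.
  have := finset.cardsC A; rewrite card_ord => E.
  by apply/eqP/eqP; lia.
rewrite card_imset; last exact: finset.setC_inj.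
rewrite cards_draws; congr 'C(_, _).
have := finset.cardsC D; rewrite card_ord; lia.
Qed.

(** Expand the square. A pair [i, j] belongs to a number of sets that depends
    only on whether [i = j]; since [Y] sums to zero, the products [Y i * Y j]
    with [j != i] sum to [- Y i ^+ 2]. *)
Lemma sum_sq_without_replacement (Y : 'I_n -> R) (k : nat) :
  (k <= n)%N -> \sum_(i < n) Y i = 0 ->
  \sum_(A in [set A : {set 'I_n} | #|A| == k]) (\sum_(i in A) Y i) ^+ 2 =
  ('C(n - 1, n - k)%:R - 'C(n - 2, n - k)%:R) * \sum_(i < n) Y i ^+ 2.
Proof.
move=> kn Y0.
have sqE (A : {set 'I_n}) : (\sum_(i in A) Y i) ^+ 2 =
    \sum_(i < n) \sum_(j < n) (([set i; j] \subset A)%:R * (Y i * Y j)).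
  rewrite expr2 mulr_suml big_mkcond; apply: eq_bigr => i _.
  rewrite mulr_sumr big_mkcond.
  case: ifP => iA; rewrite ?big_mkcond /=.
    apply: eq_bigr => j _; rewrite finset.subUset !finset.sub1set iA /=.
    by case: (j \in A); rewrite ?mul1r ?mul0r.
  by rewrite big1// => j _; rewrite finset.subUset !finset.sub1set iA mul0r.
under eq_bigr => A _ do rewrite sqE.
rewrite exchange_big /=; under eq_bigr => i _ do rewrite exchange_big /=.
have cntE i j : \sum_(A in [set A : {set 'I_n} | #|A| == k])
    (([set i; j] \subset A)%:R * (Y i * Y j)) =
    'C(n - #|[set i; j]|, n - k)%:R * (Y i * Y j).
  rewrite -mulr_suml; congr (_ * _).
  rewrite -card_supersets// -sum1_card natr_sum big_mkcond [RHS]big_mkcond /=.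
  by apply: eq_bigr => A _; rewrite !inE andbC; case: (#|A| == k); case: (_ \subset _).
under eq_bigr => i _ do under eq_bigr => j _ do rewrite cntE.
have rowE i : \sum_(j < n) 'C(n - #|[set i; j]|, n - k)%:R * (Y i * Y j) =
    ('C(n - 1, n - k)%:R - 'C(n - 2, n - k)%:R) * Y i ^+ 2.
  rewrite (bigD1 i)//= finset.setUid cards1.
  have := Y0; rewrite (bigD1 i)//= => Yi.
  have -> : \sum_(j < n | j != i) 'C(n - #|[set i; j]|, n - k)%:R * (Y i * Y j)
     = 'C(n - 2, n - k)%:R * Y i * \sum_(j < n | j != i) Y j.
    by rewrite mulr_sumr; apply: eq_bigr => j ji; rewrite cards2 eq_sym ji mulrA.
  have -> : \sum_(j < n | j != i) Y j = - Y i by lra.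
  by ring.
under eq_bigr => i _ do rewrite rowE.
by rewrite -mulr_sumr.
Qed.

(** Draws without replacement are negatively correlated, so the variance is at
    most that of [N] independent draws. The factor [N < n] records that a full
    batch is exact, which is what happens when the target size is capped at
    [n]: the bound in [1 / N] would then be too weak. *)
Lemma mean_sq_without_replacement (Y : 'I_n -> R) (N : nat) (M : R) :
  (0 < N <= n)%N -> \sum_(i < n) Y i = n%:R * M ->
  expectation (duniform R (enum [set A : {set 'I_n} | #|A| == N]))
    (fun A => (N%:R^-1 * (\sum_(i <- enum A) Y i) - M) ^+ 2)
  <= (N < n)%N%:R * (N%:R^-1 * (n%:R^-1 * \sum_(i < n) (Y i - M) ^+ 2)).
Proof.
move=> /andP[N0 Nn] YM.
have n0 : (0 < n)%N by apply: leq_trans Nn.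
have n0' : n%:R != 0 :> R by rewrite pnatr_eq0 -lt0n.
have N0' : N%:R != 0 :> R by rewrite pnatr_eq0 -lt0n.
rewrite expectation_duniform -cardE big_enum /=.
pose Z i := Y i - M.
have Z0 : \sum_(i < n) Z i = 0.
  by rewrite sumrB YM sumr_const card_ord -[M *+ _]mulr_natl subrr.
under eq_bigr => A.
  rewrite inE => /eqP AN.
  have -> : N%:R^-1 * (\sum_(i <- enum A) Y i) - M =
      N%:R^-1 * (\sum_(i in A) Z i).
    rewrite big_enum /= sumrB sumr_const AN -[M *+ _]mulr_natl.
    by field.
  rewrite exprMn.
  over.
rewrite -mulr_sumr sum_sq_without_replacement//.
have V0 : 0 <= \sum_(i < n) Z i ^+ 2 by apply: sumr_ge0 => i _; apply: sqr_ge0.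
have -> : #|[set A : {set 'I_n} | #|A| == N]| = 'C(n, n - N).
  by rewrite card_draws card_ord bin_sub.
have C0 : 'C(n, n - N)%:R != 0 :> R by rewrite pnatr_eq0 -lt0n bin_gt0 leq_subr.
have [NN|Nge] := ltnP N n; last first.
  have -> : N = n by apply/eqP; rewrite eqn_leq Nn.
  by rewrite subnn !bin0 subrr !mul0r !mulr0.
rewrite mul1r.
have bE : n%:R * 'C(n - 1, n - N)%:R = N%:R * 'C(n, n - N)%:R :> R.
  by rewrite -!natrM subn1 mul_bin_down subKn.
have -> : N%:R^-1 * (n%:R^-1 * \sum_(i < n) (Y i - M) ^+ 2) =
  'C(n, n - N)%:R^-1 * (N%:R^-1 ^+ 2 *
    ('C(n - 1, n - N)%:R * \sum_(i < n) Z i ^+ 2)).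
  have -> : 'C(n - 1, n - N)%:R = n%:R^-1 * (N%:R * 'C(n, n - N)%:R) :> R.
    by rewrite -bE mulKf.
  rewrite -/(Z _).
  by rewrite /Z; field; rewrite N0' n0' C0.
rewrite ler_wpM2l ?invr_ge0//.
rewrite ler_wpM2l ?sqr_ge0//.
rewrite ler_wpM2r//.
by rewrite gerBl.
Qed.

End Sampling.

(** * One step of the method *)

Section Smooth.
Variables (R : realType) (d n : nat) (f : 'I_n -> 'rV[R]_d -> R) (L : R).
Hypothesis n_gt0 : (0 < n)%N.
Hypothesis L_gt0 : 0 < L.
Hypothesis df : forall i x, differentiable (f i) x.
Hypothesis Lf : forall i x y,
  norm2 (gradient (f i) x - gradient (f i) y) <= L * norm2 (x - y).
Local Notation F := (favg f).
Local Notation G := (gradient (favg f)).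

Lemma gradient_favg x : G x = n%:R^-1 *: \sum_(i < n) gradient (f i) x.
Proof.
apply/rowP => j; rewrite !mxE summxE.
have -> : F = n%:R^-1 \*: (\sum_(i < n) f i).
  by apply/funext => y; rewrite /favg /= fct_sumE.
rewrite deriveZ; last by apply: derivable_sum => i; apply: diff_derivable.
rewrite derive_sum => [|i]; last exact: diff_derivable.
by congr (_ * _); apply: eq_bigr => i _; rewrite mxE.
Qed.

Lemma sum_gradient_coord x j :
  \sum_(i < n) gradient (f i) x 0 j = n%:R * G x 0 j.
Proof. by rewrite gradient_favg mxE summxE mulVKf// pnatr_eq0 -lt0n. Qed.

(** The average of the descent inequalities of the [f i]. *)
Lemma descent_favg x h :
  F (x + h) <= F x + dot (G x) h + L / 2 * norm2 h ^+ 2.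
Proof.
have n0 : n%:R != 0 :> R by rewrite pnatr_eq0 -lt0n.
have -> : F x + dot (G x) h + L / 2 * norm2 h ^+ 2 = n%:R^-1 *
    \sum_(i < n) (f i x + dot (gradient (f i) x) h + L / 2 * norm2 h ^+ 2).
  rewrite !big_split /= !mulrDr sumr_const card_ord.
  congr (_ + _ + _); last by rewrite -[X in _ = _ * X]mulr_natl mulKf.
  rewrite /dot exchange_big mulr_sumr; apply: eq_bigr => j _.
  by rewrite -mulr_suml sum_gradient_coord mulrA mulKf.
rewrite ler_wpM2l ?invr_ge0//; apply: ler_sum => i _.
exact: descent_lemma.
Qed.

(** Polarization: [2 * dot (G x) v] is the sum of the squared norms of [G x] and
    [v] minus the squared error of [v] as an estimator of [G x]. *)
Lemma descent_step (eta : R) x v :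
  F (x - eta *: v) <= F x - eta / 2 * norm2 (G x) ^+ 2
    - eta / 2 * (1 - L * eta) * norm2 v ^+ 2
    + eta / 2 * norm2 (G x - v) ^+ 2.
Proof.
have := descent_favg x (- eta *: v).
rewrite scaleNr -scaleNr dotZr norm2Z_sq norm2B_sq scaleNr; lra.
Qed.

(** The update adds to [v] an unbiased estimator of [G x' - G x]. So the old
    error survives as a bias, and the new noise has at most one [B]-th of the
    mean of [norm2 (gradient (f i) x' - gradient (f i) x) ^+ 2], which the
    Lipschitz condition bounds. Both are computed coordinate by coordinate. *)
Lemma mean_sq_spider_error (B : nat) x x' v : (0 < B)%N ->
  expectation (duniform R (enum {: B.-tuple 'I_n}))
    (fun b => norm2 (G x' -
       (batch_gradient f b x' - batch_gradient f b x + v)) ^+ 2)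
  <= norm2 (G x - v) ^+ 2 + L ^+ 2 / B%:R * norm2 (x' - x) ^+ 2.
Proof.
move=> B0; have n0 : n%:R != 0 :> R by rewrite pnatr_eq0 -lt0n.
pose Y j i := (gradient (f i) x' - gradient (f i) x) 0 j.
have -> : (fun b : B.-tuple 'I_n => norm2 (G x' -
       (batch_gradient f b x' - batch_gradient f b x + v)) ^+ 2) =
    (fun b => \sum_(j < d)
      (B%:R^-1 * (\sum_(i <- b) Y j i) + (v 0 j - G x' 0 j)) ^+ 2).
  apply/funext => b; rewrite norm2_sq; apply: eq_bigr => j _.
  rewrite -sqrrN /batch_gradient size_tuple rowBE rowDE rowBE !rowZE !summxE.
  have -> : \sum_(i <- b) Y j i = \sum_(i <- b) gradient (f i) x' 0 j
      - \sum_(i <- b) gradient (f i) x 0 j.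
    by rewrite -sumrB; apply: eq_bigr => i _; rewrite /Y rowBE.
  by congr (_ ^+ 2); ring.
rewrite expectation_sum.
have YE j : \sum_(i < n) Y j i = n%:R * (G x' 0 j - G x 0 j).
  rewrite mulrBr -!sum_gradient_coord -sumrB.
  by apply: eq_bigr => i _; rewrite /Y rowBE.
apply: (@le_trans _ _ (\sum_(j < d) ((G x 0 j - v 0 j) ^+ 2
   + B%:R^-1 * (n%:R^-1 * \sum_(i < n) Y j i ^+ 2)))).
  apply: ler_sum => j _.
  have := mean_sq_with_replacement (v 0 j - G x' 0 j) n_gt0 B0 (YE j).
  by rewrite (_ : (_ + _) ^+ 2 = (G x 0 j - v 0 j) ^+ 2)//; ring.
rewrite big_split /= -!mulr_sumr exchange_big /=.
rewrite norm2_sq (eq_bigr (fun j => (G x - v) 0 j ^+ 2)); last first.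
  by move=> j _; rewrite rowBE.
rewrite lerD2l [L ^+ 2 / _]mulrC -mulrA ler_wpM2l ?invr_ge0//.
rewrite ler_pdivrMl ?ltr0n// mulr_natl -[n in X in _ <= X]card_ord -sumr_const.
apply: ler_sum => i _; rewrite -norm2_sq -exprMn.
by rewrite ler_sqr ?nnegrE ?mulr_ge0 ?norm2_ge0 ?(ltW L_gt0).
Qed.

Lemma mean_sq_batch_error (sigma : R) (N : nat) x : (0 < N <= n)%N ->
  n%:R^-1 * \sum_(i < n) norm2 (gradient (f i) x - G x) ^+ 2 <= sigma ^+ 2 ->
  expectation (duniform R (enum [set A : {set 'I_n} | #|A| == N]))
    (fun A => norm2 (G x - batch_gradient f (enum A) x) ^+ 2)
  <= (N < n)%N%:R * (sigma ^+ 2 / N%:R).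
Proof.
move=> Nn var; pose Y j i := gradient (f i) x 0 j.
rewrite (@eq_expectation _ _ _ _ (fun A : {set 'I_n} => \sum_(j < d)
   (N%:R^-1 * (\sum_(i <- enum A) Y j i) - G x 0 j) ^+ 2)); last first.
  move=> A; rewrite outcomes_duniform mem_enum inE => /eqP AN.
  rewrite norm2_sq; apply: eq_bigr => j _.
  by rewrite -sqrrN /batch_gradient -cardE AN rowBE rowZE summxE opprB.
rewrite expectation_sum.
apply: (@le_trans _ _ (\sum_(j < d) (N < n)%N%:R *
    (N%:R^-1 * (n%:R^-1 * \sum_(i < n) (Y j i - G x 0 j) ^+ 2)))).
  by apply: ler_sum => j _; apply: mean_sq_without_replacement Nn _;
    apply: sum_gradient_coord.
rewrite -!mulr_sumr ler_wpM2l// [sigma ^+ 2 / _]mulrC ler_wpM2l ?invr_ge0//.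
apply: le_trans var; rewrite ler_wpM2l ?invr_ge0// exchange_big /=.
by apply: ler_sum => i _; rewrite norm2_sq; apply: ler_sum => j _; rewrite rowBE.
Qed.

End Smooth.

(** * Rounded outer batch sizes *)

Section Sizes.
Variables (R : realType) (rnd : R -> nat) (rndP : rounding rnd).

Lemma rounding_le (x : R) (k : nat) : 0 < x -> x <= k%:R -> (rnd x <= k)%N.
Proof.
move=> x0 xk; have [_] := rndP x0; rewrite ltr_norml => /andP[_ h].
by rewrite -ltnS -(ltr_nat R) -natr1; lra.
Qed.

Lemma rounding_ge (x : R) (k : nat) : 0 < x -> k%:R <= x -> (k <= rnd x)%N.
Proof.
move=> x0 xk; have [_] := rndP x0; rewrite ltr_norml => /andP[h _].
by rewrite -ltnS -(ltr_nat R) -natr1; lra.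
Qed.

(** Below [2] the bound holds because the rounded size is never [0]; above, because
    rounding loses less than [1]. *)
Lemma rounding_half (x : R) : 0 < x -> x <= 2 * (rnd x)%:R.
Proof.
move=> x0; have [r0] := rndP x0; rewrite ltr_norml => /andP[h _].
have : 1 <= (rnd x)%:R :> R by rewrite ler1n.
lra.
Qed.

Lemma rounding_double (x : R) : 1 <= x -> (rnd x)%:R <= 2 * x.
Proof.
move=> x1; have x0 : 0 < x by lra.
by have [_] := rndP x0; rewrite ltr_norml => /andP[_ h]; lra.
Qed.

Variables (n : nat) (sigma eps cbeta ceps : R).
Hypothesis n_gt0 : (0 < n)%N.
Hypothesis sigma_gt0 : 0 < sigma.
Hypothesis eps_gt0 : 0 < eps.
Hypothesis cbeta_ge : 16 <= cbeta.
Hypothesis ceps_ge : 16 <= ceps.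

Let cbeta_gt0 : 0 < cbeta.
Proof. by apply: lt_le_trans cbeta_ge; rewrite ltr0n. Qed.

Let ceps_gt0 : 0 < ceps.
Proof. by apply: lt_le_trans ceps_ge; rewrite ltr0n. Qed.

Let sigma2_gt0 : 0 < sigma ^+ 2.
Proof. exact: exprn_gt0. Qed.

Lemma spider_size_gt0 : 0 < spider_size n sigma eps ceps.
Proof. by rewrite lt_min ltr0n n_gt0 andbT divr_gt0// mulr_gt0. Qed.

Lemma aba_size_le beta :
  aba_size n sigma eps cbeta ceps beta <= spider_size n sigma eps ceps.
Proof. by rewrite /aba_size; case: eqP => // _; rewrite ge_min lexx orbT. Qed.

Lemma aba_size_gt0 beta : 0 <= beta ->
  0 < aba_size n sigma eps cbeta ceps beta.
Proof.
move=> b0; rewrite /aba_size; case: eqVneq => [_|bN].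
  exact: spider_size_gt0.
have bp : 0 < beta by rewrite lt_def bN.
by rewrite lt_min spider_size_gt0 andbT divr_gt0// mulr_gt0.
Qed.

(** A zero [beta] puts no cap on the batch size, and it makes the right-hand side
    false because [cbeta * sigma ^+ 2] is positive. *)
Lemma aba_size_lt beta : 0 <= beta ->
  (aba_size n sigma eps cbeta ceps beta < spider_size n sigma eps ceps)
  = (cbeta * sigma ^+ 2 < spider_size n sigma eps ceps * beta).
Proof.
move=> b0; rewrite /aba_size; case: eqVneq => [->|bN].
  by rewrite ltxx mulr0; apply/esym/negbTE; rewrite -leNgt mulr_ge0 ?ltW.
by rewrite gt_min ltxx orbF ltr_pdivrMr// lt_def bN.
Qed.

Lemma aba_batch_size beta : 0 <= beta ->
  (0 < rnd (aba_size n sigma eps cbeta ceps beta) <= n)%N.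
Proof.
move=> b0; have x0 := aba_size_gt0 b0.
rewrite (proj1 (rndP x0)) rounding_le//.
by apply: le_trans (aba_size_le _) _; rewrite ge_min lexx orbT.
Qed.

(** If the size before rounding is [n], so is the rounded one and the error is
    zero. Otherwise that size is [cbeta * sigma ^+ 2 / beta] or
    [ceps * sigma ^+ 2 / eps], so that [sigma ^+ 2] over it is at most
    [beta / 16] or [eps / 16]; rounding doubles these at worst. *)
Lemma aba_batch_variance beta : 0 <= beta ->
  let N := rnd (aba_size n sigma eps cbeta ceps beta) in
  (N < n)%N%:R * (sigma ^+ 2 / N%:R) <= beta / 8 + eps / 8.
Proof.
move=> b0 /=; set N := rnd _.
have x0 := aba_size_gt0 b0.
have be0 : 0 <= beta + eps by rewrite addr_ge0// ltW.
have [Nn|_] := ltnP N n; last by rewrite mul0r -mulrDl divr_ge0.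
have N0 : 0 < N%:R :> R by rewrite ltr0n; have /andP[] := aba_batch_size b0.
have xn : aba_size n sigma eps cbeta ceps beta < n%:R.
  rewrite ltNge; apply/negP => /(rounding_ge x0).
  by rewrite leqNgt -/N Nn.
have key : 16 * sigma ^+ 2
    <= aba_size n sigma eps cbeta ceps beta * (beta + eps).
  have sp : spider_size n sigma eps ceps < n%:R ->
      16 * sigma ^+ 2 <= spider_size n sigma eps ceps * (beta + eps).
    rewrite /spider_size gt_min ltxx orbF => /ltW/min_idPl ->.
    rewrite mulrDr divfK ?gt_eqF//.
    apply: (@le_trans _ _ (ceps * sigma ^+ 2)); first by rewrite ler_wpM2r// ltW.
    by rewrite lerDr mulr_ge0// divr_ge0 ?mulr_ge0 ?ltW.
  move: xn; rewrite /aba_size; case: eqVneq => [_|bN]; first exact: sp.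
  case: (leP (cbeta * sigma ^+ 2 / beta) (spider_size n sigma eps ceps)) => //.
  move=> _ _; rewrite mulrDr divfK//.
  apply: (@le_trans _ _ (cbeta * sigma ^+ 2)); first by rewrite ler_wpM2r// ltW.
  by rewrite lerDl mulr_ge0 ?(ltW eps_gt0)// divr_ge0// mulr_ge0 ?ltW.
have : aba_size n sigma eps cbeta ceps beta * (beta + eps)
    <= 2 * N%:R * (beta + eps) by rewrite ler_wpM2r// rounding_half.
move: key; rewrite mul1r ler_pdivrMr//; move: (sigma ^+ 2) => v.
lra.
Qed.

End Sizes.

(** * Energy along a run *)

Section Run.
Variables (R : realType) (d n : nat) (f : 'I_n -> 'rV[R]_d -> R) (L : R).
Hypothesis n_gt0 : (0 < n)%N.
Hypothesis L_gt0 : 0 < L.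
Hypothesis df : forall i x, differentiable (f i) x.
Hypothesis Lf : forall i x y,
  norm2 (gradient (f i) x - gradient (f i) y) <= L * norm2 (x - y).
Local Notation F := (favg f).
Local Notation G := (gradient (favg f)).

Variables (eta : R) (m B : nat).
Hypothesis eta_gt0 : 0 < eta.
Hypothesis m_gt0 : (0 < m)%N.
Hypothesis B_gt0 : (0 < B)%N.
Let drift := L ^+ 2 / B%:R * eta ^+ 2.
Hypothesis step_small : 8^-1 + L * eta + m%:R * drift <= 1.

(** The weight [8^-1] is what one epoch must keep from its [norm2 v ^+ 2] in
    order to pay for the error [beta / 8] of the next initial batch. *)
Definition energy (tr : trace R d) : R :=
  \sum_(p <- tr) (norm2 (G p.1) ^+ 2 + 8^-1 * norm2 p.2 ^+ 2).

Lemma energy_cons x v tr : energy ((x, v) :: tr) =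
  norm2 (G x) ^+ 2 + 8^-1 * norm2 v ^+ 2 + energy tr.
Proof. by rewrite /energy big_cons. Qed.

Lemma is_dist_minibatch :
  is_dist (duniform R (enum {: B.-tuple 'I_n})).
Proof.
by apply: is_dist_duniform; rewrite -cardE card_tuple card_ord expn_gt0 n_gt0.
Qed.

Lemma is_dist_inner_loop k x v : is_dist (inner_loop f eta B k x v).
Proof.
elim: k x v => [|k IH] x v /=; first exact: is_dist_dret.
apply: is_dist_dbind; first exact: is_dist_minibatch.
by move=> b; apply: is_dist_dbind => // tr; apply: is_dist_dret.
Qed.

Lemma size_inner_loop k x v tr :
  tr \in outcomes (inner_loop f eta B k x v) -> size tr = k.+1.
Proof.
elim: k x v tr => [|k IH] x v tr /=; first by rewrite inE => /eqP ->.
case/outcomes_dbind => b _ /outcomes_dbind[tr' /IH <-].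
by rewrite inE => /eqP ->.
Qed.

(** The current squared error is charged to each of the [k.+1] remaining steps,
    since later estimators inherit it; one more update adds at most
    [drift * norm2 v ^+ 2] to each of the [k] later charges. The assumption on
    the stepsize says that these additions, the term [L * eta] of the descent
    step and the share [8^-1] kept in the energy fit into [norm2 v ^+ 2]. *)
Lemma inner_loop_energy k x v : (k < m)%N ->
  expectation (inner_loop f eta B k x v)
    (fun tr => F (next_point eta tr) + eta / 2 * energy tr)
  <= F x + eta / 2 * (k.+1%:R * norm2 (G x - v) ^+ 2).
Proof.
have B0 : 0 < B%:R :> R by rewrite ltr0n.
have drift0 : 0 <= drift by rewrite mulr_ge0 ?sqr_ge0// divr_ge0 ?sqr_ge0 ?ltW.
have v0 (u : 'rV[R]_d) : 0 <= norm2 u ^+ 2 by apply: sqr_ge0.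
elim: k x v => [|k IH] x v km /=.
  rewrite expectation_dret /next_point /= energy_cons /energy big_nil.
  have := descent_step n_gt0 L_gt0 df Lf eta x v.
  have mdrift : 0 <= m%:R * drift by rewrite mulr_ge0.
  have : 0 <= eta / 2 * (1 - L * eta - 8^-1) * norm2 v ^+ 2.
    rewrite mulr_ge0// mulr_ge0 ?divr_ge0 ?(ltW eta_gt0)//.
    by move: step_small mdrift; move: (m%:R * drift) => b; lra.
  lra.
rewrite expectation_dbind.
pose x' := x - eta *: v.
pose v' (b : seq 'I_n) := batch_gradient f b x' - batch_gradient f b x + v.
pose c := eta / 2 * (norm2 (G x) ^+ 2 + 8^-1 * norm2 v ^+ 2).
apply: (@le_trans _ _ (expectation (duniform R (enum {: B.-tuple 'I_n}))
   (fun b => (c + F x') + eta / 2 * k.+1%:R * norm2 (G x' - v' b) ^+ 2))).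
  apply: expectation_le; first exact: is_dist_minibatch.
  move=> b; rewrite expectation_dbind -/x' -/(v' b).
  rewrite (@eq_expectation _ _ _ _
    (fun tr => c + (F (next_point eta tr) + eta / 2 * energy tr))).
    rewrite expectationD expectation_cst; last exact: is_dist_inner_loop.
    by rewrite -addrA lerD2l -mulrA; apply: IH; apply: ltnW.
  move=> tr /size_inner_loop str; rewrite expectation_dret energy_cons /c.
  have -> : next_point eta ((x, v) :: tr) = next_point eta tr.
    by case: tr str.
  by ring.
rewrite expectationD expectation_cst; last exact: is_dist_minibatch.
rewrite expectationZ.
have := mean_sq_spider_error n_gt0 L_gt0 df Lf x x' v B_gt0.
rewrite -/v' (_ : x' - x = - eta *: v); last by rewrite /x' addrAC subrr add0r scaleNr.
rewrite norm2Z_sq sqrrN mulrA -/drift.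
set E := expectation _ _ => HE.
have {}HE : eta / 2 * k.+1%:R * E <= eta / 2 * k.+1%:R *
    (norm2 (G x - v) ^+ 2 + drift * norm2 v ^+ 2).
  by rewrite ler_wpM2l// mulr_ge0// divr_ge0// ltW.
have := descent_step n_gt0 L_gt0 df Lf eta x v; rewrite -/x'.
have kdrift : k.+1%:R * drift <= m%:R * drift by rewrite ler_wpM2r// ler_nat ltnW.
have : 0 <= eta / 2 * (1 - L * eta - 8^-1 - k.+1%:R * drift) * norm2 v ^+ 2.
  rewrite mulr_ge0// mulr_ge0 ?divr_ge0 ?(ltW eta_gt0)//.
  by move: step_small kdrift; move: (m%:R * drift) (_ * drift) => a b; lra.
rewrite -[k.+2%:R]natr1 /c; move: HE.
move: (norm2 v ^+ 2) (norm2 (G x) ^+ 2) (norm2 (G x - v) ^+ 2) k.+1%:R => nv ng ne kk.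
lra.
Qed.

Variables (rnd : R -> nat) (sigma eps cbeta ceps : R).
Hypothesis rndP : rounding rnd.
Hypothesis sigma_gt0 : 0 < sigma.
Hypothesis eps_gt0 : 0 < eps.
Hypothesis cbeta_ge : 16 <= cbeta.
Hypothesis ceps_ge : 16 <= ceps.
Hypothesis var : forall x,
  n%:R^-1 * \sum_(i < n) norm2 (gradient (f i) x - G x) ^+ 2 <= sigma ^+ 2.
Local Notation N := (fun beta => rnd (aba_size n sigma eps cbeta ceps beta)).
Local Notation run := (abaspider_run f rnd sigma eps cbeta ceps eta m B).

Lemma next_beta_ge0 (tr : trace R d) : 0 <= next_beta m tr.
Proof. by rewrite mulr_ge0 ?invr_ge0// sumr_ge0// => p _; apply: sqr_ge0. Qed.

Lemma energyE tr : energy tr =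
  \sum_(p <- tr) norm2 (G p.1) ^+ 2 + 8^-1 * (m%:R * next_beta m tr).
Proof.
by rewrite /energy big_split /= -mulr_sumr /next_beta mulVKf// pnatr_eq0 -lt0n.
Qed.

Lemma is_dist_outer_batch k : (k <= n)%N ->
  is_dist (duniform R (enum [set A : {set 'I_n} | #|A| == k])).
Proof.
by move=> kn; apply: is_dist_duniform; rewrite -cardE card_draws card_ord bin_gt0.
Qed.

Lemma is_dist_epoch k x : (k <= n)%N -> is_dist (epoch f eta m B k x).
Proof.
move=> kn; apply: is_dist_dbind; first exact: is_dist_outer_batch.
by move=> A; apply: is_dist_inner_loop.
Qed.

Lemma is_dist_run S beta x : 0 <= beta -> is_dist (run S beta x).
Proof.
elim: S beta x => [|S IH] beta x b0 /=; first exact: is_dist_dret.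
apply: is_dist_dbind.
  by apply: is_dist_epoch; have /andP[] := aba_batch_size rndP n_gt0 sigma_gt0
    eps_gt0 cbeta_ge ceps_ge b0.
move=> tr; apply: is_dist_dbind; first exact/IH/next_beta_ge0.
by move=> r; apply: is_dist_dret.
Qed.

Lemma size_run S beta x r : r \in outcomes (run S beta x) ->
  size (flatten r) = (S * m)%N.
Proof.
elim: S beta x r => [|S IH] beta x r /=; first by rewrite inE => /eqP ->.
case/outcomes_dbind => tr /outcomes_dbind[A _ /size_inner_loop str].
case/outcomes_dbind => r' /IH sr'; rewrite inE => /eqP ->.
by rewrite /= size_cat sr' str prednK// mulSn.
Qed.

(** The error of the initial batch gradient is charged to all [m] steps. *)
Lemma epoch_energy beta x : 0 <= beta ->
  expectation (epoch f eta m B (N beta) x)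
    (fun tr => F (next_point eta tr) + eta / 2 * energy tr)
  <= F x + eta / 2 * (m%:R * (beta / 8 + eps / 8)).
Proof.
move=> b0.
have szN := aba_batch_size rndP n_gt0 sigma_gt0 eps_gt0 cbeta_ge ceps_ge b0.
have N_le : (N beta <= n)%N by case/andP: szN.
rewrite /epoch expectation_dbind.
apply: (@le_trans _ _ (expectation
  (duniform R (enum [set A : {set 'I_n} | #|A| == N beta]))
  (fun A => F x + eta / 2 * m%:R *
     norm2 (G x - batch_gradient f (enum A) x) ^+ 2))).
  apply: expectation_le; first exact: is_dist_outer_batch.
  have pm : (m.-1 < m)%N by rewrite prednK.
  move=> A; have := inner_loop_energy x (batch_gradient f (enum A) x) pm.
  by rewrite prednK// mulrA.
rewrite expectationD expectation_cst; last exact: is_dist_outer_batch.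
rewrite expectationZ lerD2l mulrA ler_wpM2l//.
  by rewrite mulr_ge0// divr_ge0// ltW.
apply: le_trans (mean_sq_batch_error n_gt0 df szN (var x)) _.
exact: aba_batch_variance.
Qed.

(** Telescoping over the epochs, from the last one backwards. What the energy of
    an epoch keeps, [m * next_beta / 8], is exactly the term in [beta] of the
    bound for the run that follows it. *)
Lemma run_energy S beta x (Fmin : R) : (forall y, Fmin <= F y) -> 0 <= beta ->
  expectation (run S beta x)
    (fun r => \sum_(p <- flatten r) norm2 (G p.1) ^+ 2)
  <= 2 / eta * (F x - Fmin) + m%:R * (beta / 8 + S%:R * (eps / 8)).
Proof.
move=> Fmin_le.
have m0 : 0 < m%:R :> R by rewrite ltr0n.
have e2 : 0 < 2 / eta by rewrite divr_gt0.
elim: S beta x => [|S IH] beta x b0 /=.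
  rewrite expectation_dret /= big_nil mul0r addr0 addr_ge0//.
    by rewrite mulr_ge0 ?subr_ge0// ltW.
  by rewrite mulr_ge0 ?divr_ge0// ltW.
have N_le : (N beta <= n)%N.
  by have /andP[] := aba_batch_size rndP n_gt0 sigma_gt0 eps_gt0 cbeta_ge ceps_ge b0.
rewrite expectation_dbind.
apply: (@le_trans _ _ (expectation (epoch f eta m B (N beta) x)
   (fun tr => (m%:R * (S%:R * (eps / 8)) - 2 / eta * Fmin) +
      2 / eta * (F (next_point eta tr) + eta / 2 * energy tr)))).
  apply: expectation_le; first exact: is_dist_epoch.
  move=> tr; rewrite expectation_dbind.
  have -> : (fun r => expectation (dret R (tr :: r))
      (fun r => \sum_(p <- flatten r) norm2 (G p.1) ^+ 2)) =
     (fun r => \sum_(p <- tr) norm2 (G p.1) ^+ 2 +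
               \sum_(p <- flatten r) norm2 (G p.1) ^+ 2).
    by apply/funext => r; rewrite expectation_dret /= big_cat.
  have nb0 := next_beta_ge0 tr.
  rewrite expectationD expectation_cst; last exact: is_dist_run.
  have := IH _ (next_point eta tr) nb0.
  have -> : 2 / eta * (F (next_point eta tr) + eta / 2 * energy tr) =
     2 / eta * F (next_point eta tr) + energy tr.
    by rewrite mulrDr; congr (_ + _); field; rewrite gt_eqF.
  rewrite energyE.
  move: (\sum_(p <- tr) _) (expectation _ _) => A E; lra.
rewrite expectationD expectation_cst; last exact: is_dist_epoch.
rewrite expectationZ.
have := epoch_energy x b0; set E := expectation _ _ => HE.
have {}HE := ler_wpM2l (ltW e2) HE.
have E2 : 2 / eta * (eta / 2 * (m%:R * (beta / 8 + eps / 8))) =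
   m%:R * (beta / 8 + eps / 8) by field; rewrite gt_eqF.
move: HE; rewrite mulrDr E2 -[S.+1%:R]natr1; lra.
Qed.

Lemma abaspider_expectation S beta x (Fmin : R) :
  (forall y, Fmin <= F y) -> (0 < S)%N -> 0 <= beta ->
  expectation (abaspider f rnd sigma eps cbeta ceps eta m B S beta x)
    (fun y => norm2 (G y) ^+ 2)
  <= (2 / eta * (F x - Fmin)) / (S%:R * m%:R) + beta / (8 * S%:R) + eps / 8.
Proof.
move=> Fmin_le S_gt0 b0.
have m0 : 0 < m%:R :> R by rewrite ltr0n.
have S0 : 0 < S%:R :> R by rewrite ltr0n.
rewrite /abaspider expectation_dbind.
rewrite (@eq_expectation _ _ _ _ (fun r => (S%:R * m%:R)^-1 *
  \sum_(p <- flatten r) norm2 (G p.1) ^+ 2)); last first.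
  move=> r /size_run sr.
  by rewrite expectation_duniform size_map sr natrM big_map.
rewrite expectationZ ler_pdivrMl ?mulr_gt0//.
apply: le_trans (run_energy _ _ Fmin_le b0) _.
rewrite le_eqVlt; apply/orP; left; apply/eqP.
by field; rewrite !gt_eqF.
Qed.

End Run.

(** * Comparison of oracle costs *)

Lemma beta_of_ge0 (R : realType) d m (beta1 : R) (r : seq (trace R d)) s :
  0 <= beta1 -> 0 <= beta_of m beta1 r s.
Proof.
move=> b0; rewrite /beta_of; case: s => [|s] //=.
have [sr|sr] := ltnP s (size r); last by rewrite nth_default ?size_map.
by rewrite (nth_map [::])// next_beta_ge0.
Qed.

Lemma spider_sfo_sum (R : realType) n (sigma eps ceps : R) m B S :
  spider_sfo n sigma eps ceps m B S =
  \sum_(s < S) spider_size n sigma eps ceps + (S * m * B)%:R.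
Proof. by rewrite /spider_sfo sumr_const card_ord mulr_natl. Qed.

(** Termwise comparison; keeping track of the case of equality in each term gives
    the criterion for a strict gain. *)
Lemma abaspider_sfo_leif (R : realType) d n (sigma eps cbeta ceps beta1 : R)
    m B S (r : seq (trace R d)) :
  abaspider_sfo n sigma eps cbeta ceps m B S beta1 r
    <= spider_sfo n sigma eps ceps m B S
  ?= iff [forall s : 'I_S,
    aba_size n sigma eps cbeta ceps (beta_of m beta1 r s)
      == spider_size n sigma eps ceps].
Proof.
rewrite spider_sfo_sum /abaspider_sfo; set q := _%:R.
have [le_sum eq_sum] := leif_sum (fun (s : 'I_S) (_ : true) => leif_eq
  (aba_size_le n sigma eps cbeta ceps (beta_of m beta1 r s))).
by split; [rewrite lerD2r|rewrite (inj_eq (addIr q))].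
Qed.

(** * Parameter choice *)

Section ParameterChoice.
Variables (R : realType) (rnd : R -> nat) (n B : nat) (eps L : R).
Hypothesis rndP : rounding rnd.
Hypothesis L_gt0 : 0 < L.
Hypothesis eps_gt0 : 0 < eps.
Hypothesis B_gt0 : (0 < B)%N.
Hypothesis B_le : B%:R <= Num.min (Num.sqrt n%:R) (Num.sqrt eps)^-1.
Let M := Num.min n%:R eps^-1.
Let m := rnd (M / B%:R).
Let eta := (4 * L)^-1 * Num.sqrt (B%:R / m%:R).

Let B0 : 0 < B%:R :> R. Proof. by rewrite ltr0n. Qed.
Let B1 : 1 <= B%:R :> R. Proof. by rewrite ler1n. Qed.

Lemma batch_sq_le : B%:R ^+ 2 <= M.
Proof.
move: B_le; rewrite le_min => /andP[Bn Be].
rewrite le_min; apply/andP; split.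
  by rewrite -(sqr_sqrtr (ler0n R n)) ler_sqr ?nnegrE ?sqrtr_ge0.
rewrite -(sqr_sqrtr (ltW eps_gt0)) -exprVn.
by rewrite ler_sqr ?nnegrE ?invr_ge0 ?sqrtr_ge0.
Qed.

Lemma effective_size_ge1 : 1 <= M.
Proof. by apply: le_trans batch_sq_le; rewrite expr_ge1// ltW. Qed.

Lemma data_size_gt0 : (0 < n)%N.
Proof.
rewrite -(ltr_nat R); have := effective_size_ge1; rewrite le_min => /andP[n1 _].
exact: lt_le_trans ltr01 n1.
Qed.

Lemma epoch_ge_batch : B%:R <= M / B%:R.
Proof. by rewrite ler_pdivlMr// -expr2 batch_sq_le. Qed.

Let z_gt0 : 0 < M / B%:R. Proof. exact: lt_le_trans epoch_ge_batch. Qed.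

Lemma epoch_length_gt0 : (0 < m)%N.
Proof. by have [] := rndP z_gt0. Qed.

Let m0 : 0 < m%:R :> R. Proof. by rewrite ltr0n epoch_length_gt0. Qed.

Lemma batch_le_epoch_length : (B <= m)%N.
Proof. exact: rounding_ge epoch_ge_batch. Qed.

Lemma epoch_work_ge : M <= 2 * (m%:R * B%:R).
Proof. by rewrite mulrA -ler_pdivrMr// rounding_half. Qed.

Lemma epoch_work_le : m%:R * B%:R <= 2 * M.
Proof.
rewrite -ler_pdivlMr// -mulrA; apply: rounding_double => //.
exact: le_trans epoch_ge_batch.
Qed.

Lemma stepsize_gt0 : 0 < eta.
Proof. by rewrite mulr_gt0 ?invr_gt0 ?mulr_gt0// sqrtr_gt0 divr_gt0. Qed.

(** The drift is [1 / (16 * m)], and [L * eta] is at most [1 / 4] because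
    [B <= m]; and [1 / 8 + 1 / 4 + 1 / 16 <= 1]. *)
Lemma stepsize_small :
  8^-1 + L * eta + m%:R * (L ^+ 2 / B%:R * eta ^+ 2) <= 1.
Proof.
have BmR : B%:R / m%:R <= 1 :> R.
  by rewrite ler_pdivrMr// mul1r ler_nat batch_le_epoch_length.
have s1 : Num.sqrt (B%:R / m%:R) <= 1 :> R by rewrite -[leRHS]sqrtr1 ler_sqrt.
have -> : m%:R * (L ^+ 2 / B%:R * eta ^+ 2) = 16^-1.
  rewrite /eta exprMn sqr_sqrtr ?divr_ge0//.
  by field; rewrite !gt_eqF.
have -> : L * eta = 4^-1 * Num.sqrt (B%:R / m%:R).
  by rewrite /eta; field; rewrite gt_eqF.
lra.
Qed.

(** By definition [eta * m] is [Num.sqrt (B * m) / (4 * L)], and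
    [B * m >= M / 2] after rounding. *)
Lemma stepsize_times_length : (8 * L)^-1 * Num.sqrt M <= eta * m%:R.
Proof.
have M0 : 0 <= M by apply: le_trans effective_size_ge1.
rewrite (_ : (8 * L)^-1 * _ = (4 * L)^-1 * (2^-1 * Num.sqrt M)); last first.
  by field; rewrite gt_eqF.
rewrite /eta -mulrA ler_wpM2l ?invr_ge0 ?mulr_ge0 ?(ltW L_gt0)//.
rewrite -ler_sqr ?nnegrE ?mulr_ge0 ?sqrtr_ge0 ?invr_ge0//.
rewrite !exprMn !sqr_sqrtr ?divr_ge0//.
have -> : B%:R / m%:R * m%:R ^+ 2 = B%:R * m%:R :> R.
  by rewrite expr2 mulrA divfK ?gt_eqF.
have := epoch_work_ge; lra.
Qed.

(** From [1 <= M <= eps^-1] one gets [Num.sqrt M <= eps^-1]. It absorbs the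
    one epoch added when the number of epochs is rounded up. *)
Lemma effective_size_le : M <= eps^-1 * Num.sqrt M.
Proof.
have M0 : 0 <= M by apply: le_trans effective_size_ge1.
have Me : M <= eps^-1 by rewrite ge_min lexx orbT.
have e1 : 1 <= eps^-1 by apply: le_trans effective_size_ge1 Me.
rewrite -{1}(sqr_sqrtr M0) expr2 ler_wpM2r ?sqrtr_ge0//.
rewrite -ler_sqr ?nnegrE ?sqrtr_ge0 ?(le_trans _ e1)// sqr_sqrtr//.
by apply: le_trans Me _; rewrite expr2 ler_peMl// (le_trans _ e1).
Qed.

Lemma spider_size_le (sigma ceps : R) : 0 <= ceps ->
  spider_size n sigma eps ceps <= (ceps * sigma ^+ 2 + 1) * M.
Proof.
move=> c0; have M0 : 0 <= M by apply: le_trans effective_size_ge1.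
have cs : 0 <= ceps * sigma ^+ 2 by rewrite mulr_ge0// sqr_ge0.
rewrite /spider_size /M; case: (leP n%:R eps^-1) => _.
  rewrite ge_min; apply/orP; right.
  by rewrite ler_peMl// lerDr.
rewrite ge_min; apply/orP; left.
by rewrite ler_wpM2r ?invr_ge0 ?(ltW eps_gt0)// lerDl.
Qed.

Variables (D : R).
Hypothesis D_ge0 : 0 <= D.

(** By [eta * m >= Num.sqrt M / (8 * L)], the initial gap [D] contributes at most
    [2 / 3 * eps] to the mean squared gradient as soon as the number of epochs
    is at least the quotient below. *)
Definition epochs : nat := (Num.truncn (24 * L * D / (eps * Num.sqrt M))).+1.

Let sM0 : 0 < Num.sqrt M.
Proof. by rewrite sqrtr_gt0; apply: lt_le_trans effective_size_ge1. Qed.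

Let T_ge0 : 0 <= 24 * L * D / (eps * Num.sqrt M).
Proof. by rewrite divr_ge0 ?mulr_ge0 ?(ltW L_gt0) ?(ltW eps_gt0) ?sqrtr_ge0. Qed.

Lemma epochs_ge : 24 * L * D <= epochs%:R * (eps * Num.sqrt M).
Proof. by rewrite -ler_pdivrMr ?mulr_gt0// ltW// truncnS_gt. Qed.

Lemma epochs_le : epochs%:R * M <= (24 * L * D + 1) * (eps^-1 * Num.sqrt M).
Proof.
have M0 : 0 <= M by apply: le_trans effective_size_ge1.
have := effective_size_le; rewrite mulrDl mul1r => Ms.
apply: (@le_trans _ _ ((24 * L * D / (eps * Num.sqrt M) + 1) * M)).
  by rewrite ler_wpM2r// /epochs -natr1 lerD2r truncn_le.
rewrite mulrDl mul1r lerD//.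
rewrite -[X in _ * X <= _](sqr_sqrtr M0) le_eqVlt; apply/orP; left; apply/eqP.
by field; rewrite !gt_eqF.
Qed.

(** The choice of the number of epochs gives [2 / 3 * eps]; the bound
    [3 / 4 * eps] leaves [eps / 4] for the two other terms. *)
Lemma epochs_accuracy (Delta : R) : Delta <= D ->
  2 / eta * Delta / (epochs%:R * m%:R) <= 3 / 4 * eps.
Proof.
move=> DD; have S0 : 0 < epochs%:R :> R by rewrite ltr0n.
have e0 := stepsize_gt0.
rewrite ler_pdivrMr ?mulr_gt0// mulrAC ler_pdivrMr//.
have h1 := epochs_ge; have h2 := stepsize_times_length.
have {}h2 : Num.sqrt M <= 8 * L * (eta * m%:R).
  by rewrite -ler_pdivrMl// mulr_gt0.
have h3 : epochs%:R * eps * Num.sqrt M <= epochs%:R * eps * (8 * L * (eta * m%:R)).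
  by rewrite ler_wpM2l// mulr_ge0// ltW.
have h4 : L * (24 * D) <= L * (8 * (epochs%:R * eps * (eta * m%:R))) by lra.
move: h4; rewrite ler_pM2l// (_ : 3 / 4 * eps * _ * _
  = 3 / 4 * (epochs%:R * eps * (eta * m%:R))); last by ring.
by move: D_ge0; lra.
Qed.

End ParameterChoice.

(** * Complexity of AbaSPIDER *)

Local Open Scope classical_set_scope.
Local Open Scope ring_scope.

Theorem corollary2 (R : realType) (d : nat) (rnd : R -> nat)
    (L sigma cbeta ceps Delta : R) :
  rounding rnd ->
  0 < L -> 0 < sigma -> 16 <= cbeta -> 16 <= ceps ->
  exists C : R, 0 < C /\
  forall (n : nat) (f : 'I_n -> 'rV[R]_d -> R) (x0 : 'rV[R]_d)
         (eps : R) (B : nat),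
    (forall i x, differentiable (f i) x) ->
    (forall i x y, norm2 (gradient (f i) x - gradient (f i) y)
                     <= L * norm2 (x - y)) ->
    has_lbound (range (favg f)) ->
    favg f x0 - inf (range (favg f)) <= Delta ->
    (forall x, n%:R^-1 * \sum_(i < n)
                 norm2 (gradient (f i) x - gradient (favg f) x) ^+ 2
               <= sigma ^+ 2) ->
    0 < eps ->
    (0 < B)%N ->
    B%:R <= Num.min (Num.sqrt n%:R) (Num.sqrt eps)^-1 ->
    let m := rnd (Num.min n%:R eps^-1 / B%:R) in
    let eta := (4 * L)^-1 * Num.sqrt (B%:R / m%:R) in
    exists S : nat, (0 < S)%N /\
    (forall beta1 : R, 0 < beta1 -> beta1 <= S%:R * eps ->
      expectation
        (abaspider f rnd sigma eps cbeta ceps eta m B S beta1 x0)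
        (fun x => norm2 (gradient (favg f) x) ^+ 2) <= eps
      /\
      forall r, r \in outcomes
          (abaspider_run f rnd sigma eps cbeta ceps eta m B S beta1 x0) ->
        abaspider_sfo n sigma eps cbeta ceps m B S beta1 r
          <= spider_sfo n sigma eps ceps m B S
        /\
        (abaspider_sfo n sigma eps cbeta ceps m B S beta1 r
           < spider_sfo n sigma eps ceps m B S
         <-> exists s : 'I_S,
               cbeta * sigma ^+ 2
                 < spider_size n sigma eps ceps * beta_of m beta1 r s))
    /\
    spider_sfo n sigma eps ceps m B S
      <= C * (eps^-1 * Num.sqrt (Num.min n%:R eps^-1)).
Proof.
move=> rndP L0 sigma0 cb16 ce16.
have ce0 : 0 <= ceps by apply: le_trans ce16; rewrite ler0n.
pose D := `|Delta|; have D0 : 0 <= D by apply: normr_ge0.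
have cs0 : 0 <= ceps * sigma ^+ 2 by rewrite mulr_ge0// sqr_ge0.
have K0 : 0 <= 24 * L * D by rewrite !mulr_ge0// ltW.
(* An epoch costs at most [(ceps * sigma ^+ 2 + 1) * M] calls for the initial
   batch and [2 * M] for the mini-batches. The second factor bounds the number
   of epochs times [M], in units of [eps^-1 * Num.sqrt M]. *)
exists ((ceps * sigma ^+ 2 + 3) * (24 * L * D + 1)); split.
  by rewrite mulr_gt0// ltr_wpDl.
move=> n f x0 eps B df Lf lbF Delta_ge var eps0 B0 B_le m eta.
have n0 := data_size_gt0 eps0 B0 B_le.
have m0 : (0 < m)%N := epoch_length_gt0 rndP eps0 B0 B_le.
have eta0 : 0 < eta := stepsize_gt0 rndP L0 eps0 B0 B_le.
pose S := epochs n eps L D; exists S; split=> //; split; last first.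
  pose M := Num.min n%:R eps^-1 : R.
  have SM : S%:R * M <= _ := epochs_le L0 eps0 B0 B_le D0.
  have spM := spider_size_le eps0 B0 B_le sigma ce0.
  have mB : m%:R * B%:R <= 2 * M := epoch_work_le rndP eps0 B0 B_le.
  rewrite -mulrA; apply: (@le_trans _ _ ((ceps * sigma ^+ 2 + 3) * (S%:R * M))).
    rewrite /spider_sfo !natrM -mulrA -mulrDr mulrCA ler_wpM2l//.
    have -> : (ceps * sigma ^+ 2 + 3) * M = (ceps * sigma ^+ 2 + 1) * M + 2 * M.
      by ring.
    exact: lerD.
  by rewrite ler_wpM2l// addr_ge0.
move=> beta1 b0 bS; have b0' := ltW b0; split.
  have Fmin y : inf (range (favg f)) <= favg f y by apply: ge_inf => //; exists y.
  have small := stepsize_small rndP L0 eps0 B0 B_le.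
  have H := abaspider_expectation n0 L0 df Lf eta0 m0 B0 small rndP sigma0 eps0
    cb16 ce16 var x0 Fmin (isT : (0 < S)%N) b0'.
  apply: le_trans H _.
  have acc := epochs_accuracy rndP L0 eps0 B0 B_le D0 (le_trans Delta_ge (ler_norm _)).
  have S0 : 0 < S%:R :> R by rewrite ltr0n.
  have bS8 : beta1 / (8 * S%:R) <= eps / 8.
    by rewrite ler_pdivrMr ?mulr_gt0//; lra.
  apply: (@le_trans _ _ (3 / 4 * eps + eps / 8 + eps / 8)); last by lra.
  by rewrite lerD2r lerD.
move=> r _; have sfo := abaspider_sfo_leif n sigma eps cbeta ceps beta1 m B S r.
split; first exact: leif_le sfo.
rewrite (lt_leif sfo) negb_forall.
have strict (s : 'I_S) : (aba_size n sigma eps cbeta ceps (beta_of m beta1 r s)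
    != spider_size n sigma eps ceps) = (cbeta * sigma ^+ 2
                 < spider_size n sigma eps ceps * beta_of m beta1 r s).
  by rewrite -aba_size_lt ?beta_of_ge0// lt_def aba_size_le andbT eq_sym.
split=> [/existsP[s]|[s]]; rewrite ?strict -?strict => sP.
  by exists s; rewrite -strict.
by apply/existsP; exists s.
Qed.
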